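(* The class of graphs that have an inside-obstacle representation and the class of graphs that have an outside-obstacle representation are incomparable, i.e., neither class is contained in the other.
   Context: An obstacle is a topologically open, non-self-intersecting polygonal region in the plane (possibly unbounded). Given an obstacle $C$ and a finite set $P$ of points in general position in the complement of $C$, the visibility graph $G_C(P)$ has vertex set $P$ and an edge $pq$ exactly when $\overline{pq}\cap C=\emptyset$; its straight-line drawing is the visibility drawing. A single-obstacle representation of $G$ is a pair $(P,C)$ with $G\cong G_C(P)$; it is an outside-obstacle representation if $C$ lies in the unbounded component of the complement of the visibility drawing, and an inside-obstacle representation if $C$ lies in the complement of that unbounded component. *)

(* Defs.v *)
From HB Require Import structures.
From mathcomp Require Import all_boot all_order all_algebra.
From mathcomp Require Import all_classical all_reals all_analysis.
Set Implicit Arguments. Unset Strict Implicit. Unset Printing Implicit Defensive.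
Import Order.TTheory GRing.Theory Num.Theory.
Import numFieldNormedType.Exports.
Local Open Scope ring_scope.
Local Open Scope classical_set_scope.

Section Obstacles.
Variable R : realType.

Local Notation pt := (R * R)%type.
Definition porig : pt := (0, 0).
Definition padd (p q : pt) : pt := (p.1 + q.1, p.2 + q.2).
Definition pscale (t : R) (p : pt) : pt := (t * p.1, t * p.2).

Definition seg (a b : pt) : set pt :=
  [set p | exists2 t : R, 0 <= t <= 1 & p = padd (pscale (1 - t) a) (pscale t b)].
Definition ray (a d : pt) : set pt :=
  [set p | exists2 t : R, 0 <= t & p = padd a (pscale t d)].

Definition collinear (a b c : pt) : bool :=
  (b.1 - a.1) * (c.2 - a.2) == (b.2 - a.2) * (c.1 - a.1).

Definition bounded_pt (A : set pt) : Prop :=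
  exists M : R, forall p, A p -> `|p.1| <= M /\ `|p.2| <= M.

Definition pedge (s : seq pt) (i : nat) : set pt :=
  seg (nth porig s i) (nth porig s ((i.+1 %% size s)%N)).

Definition simple_closed_polygon (s : seq pt) : Prop :=
  (3 <= size s)%N /\
  (forall i, (i < size s)%N -> nth porig s i != nth porig s ((i.+1 %% size s)%N)) /\
  (forall i j, (i < size s)%N -> (j < size s)%N -> i != j ->
     pedge s i `&` pedge s j =
       if j == (i.+1 %% size s)%N then [set nth porig s j]
       else if i == (j.+1 %% size s)%N then [set nth porig s i]
       else set0).

Definition polygon_set (s : seq pt) : set pt :=
  [set p | exists2 i, (i < size s)%N & pedge s i p].

(* Unbounded case: a simple polygonal chain consisting of a ray ending at
   s_0, segments s_0 s_1, ..., s_{k-2} s_{k-1}, and a ray starting at s_{k-1}. *)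
Definition chain_piece (s : seq pt) (a b : pt) (i : nat) : set pt :=
  if i == 0%N then ray (nth porig s 0) a
  else if i == size s then ray (nth porig s (size s).-1) b
  else seg (nth porig s i.-1) (nth porig s i).

Definition simple_unbounded_chain (s : seq pt) (a b : pt) : Prop :=
  (1 <= size s)%N /\ a != porig /\ b != porig /\
  (forall i, (i.+1 < size s)%N -> nth porig s i != nth porig s i.+1) /\
  (forall i j, (i < j)%N -> (j <= size s)%N ->
     chain_piece s a b i `&` chain_piece s a b j =
       if j == i.+1 then [set nth porig s i] else set0).

Definition chain_set (s : seq pt) (a b : pt) : set pt :=
  [set p | exists2 i, (i <= size s)%N & chain_piece s a b i p].

(* An obstacle: an open polygonal region whose boundary is a single
   non-self-intersecting polygonal curve (closed polygon, or a chain through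
   infinity), namely a connected component of the complement of that curve. *)
Definition obstacle (C : set pt) : Prop :=
  open C /\
  exists Gamma : set pt,
    ((exists s, simple_closed_polygon s /\ Gamma = polygon_set s) \/
     (exists s a b, simple_unbounded_chain s a b /\ Gamma = chain_set s a b)) /\
    exists2 x, ~ Gamma x & C = connected_component (~` Gamma) x.

Variables (V : finType) (adj : rel V).

Definition general_position (f : V -> pt) : Prop :=
  injective f /\
  forall u v w, u != v -> v != w -> u != w -> ~~ collinear (f u) (f v) (f w).

Definition obstacle_rep (C : set pt) (f : V -> pt) : Prop :=
  obstacle C /\ general_position f /\ (forall v, ~ C (f v)) /\
  forall u v, u != v -> (adj u v <-> seg (f u) (f v) `&` C = set0).

Definition drawing (f : V -> pt) : set pt :=
  [set p | (exists v, p = f v) \/ exists u v, adj u v /\ seg (f u) (f v) p].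

Definition outside_rep (C : set pt) (f : V -> pt) : Prop :=
  obstacle_rep C f /\
  exists2 x, ~ drawing f x &
    ~ bounded_pt (connected_component (~` drawing f) x) /\
    C `<=` connected_component (~` drawing f) x.

Definition inside_rep (C : set pt) (f : V -> pt) : Prop :=
  obstacle_rep C f /\
  forall x, ~ drawing f x ->
    ~ bounded_pt (connected_component (~` drawing f) x) ->
    C `&` connected_component (~` drawing f) x = set0.

Definition has_outside_rep : Prop := exists C f, outside_rep C f.
Definition has_inside_rep : Prop := exists C f, inside_rep C f.

End Obstacles.

Definition simple_graph (V : finType) (adj : rel V) : Prop :=
  symmetric adj /\ irreflexive adj.

(* Main.v *)
Require Import Defs.
From mathcomp Require Import all_boot all_order all_algebra.
From mathcomp Require Import all_classical all_reals all_analysis.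
From mathcomp Require Import ring lra.
Set Implicit Arguments. Unset Strict Implicit. Unset Printing Implicit Defensive.
Import Order.TTheory GRing.Theory Num.Theory.
Import numFieldNormedType.Exports.
Local Open Scope ring_scope.
Local Open Scope classical_set_scope.

(* Inside but not outside.  Place the pairs p_i q_i (i < 4) as opposite vertices
   of an octagon around a small triangular obstacle, and two more points c, d on
   its sides, so that c sees exactly the p_i and d exactly q_0, q_1, q_2, p_3.
   In an outside representation no non-edge uv can be surrounded by two walks of
   the drawing from u to v, one on each side of the line uv; in particular the
   other six p's and q's all lie on the same side o_i of the directed line
   p_i q_i.  The orientations of the nine points p_i, q_i, c then satisfy a set
   of clauses refuting o_i = o_j = o_k for distinct i, j, k.  For d the same
   holds with o_0, o_1, o_2 negated, and both constraints together are
   unsatisfiable.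

   Outside but not inside.  The drawing of a star is star-shaped about its
   centre, so its complement has no bounded component; the path on three
   vertices already works. *)

(** * Crossing parity of a polygonal walk *)

Section Plane.
Variable R : realType.
Local Notation pt := (R * R)%type.
Implicit Types a b c u v w z : pt.

Definition det a b c : R :=
  (b.1 - a.1) * (c.2 - a.2) - (b.2 - a.2) * (c.1 - a.1).

Lemma det_continuous a b : continuous (det a b).
Proof.
move=> z; apply: cvgB; apply: cvgM; try exact: cvg_cst.
- by apply: cvgB; [exact: cvg_snd|exact: cvg_cst].
- by apply: cvgB; [exact: cvg_fst|exact: cvg_cst].
Qed.

(* Does the vertical ray going up from z cross ab?  The edge is taken half-open
   in the first coordinate, so that a vertex above z is counted once. *)
Definition crosses a b z : bool :=
  if a.1 <= z.1 then (z.1 < b.1) && (det a b z < 0)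
  else (b.1 <= z.1) && (0 < det a b z).

(* [crosses a b] is not locally constant off ab: it changes when z passes below
   an end of the edge. These jumps cancel between consecutive edges. *)
Definition jump a z z' : bool :=
  ((a.1 <= z.1) (+) (a.1 <= z'.1)) && (z.2 < a.2).

Lemma crossesC a b z : crosses a b z = crosses b a z.
Proof.
have e : det b a z = - det a b z by rewrite /det; ring.
rewrite /crosses e oppr_lt0 oppr_gt0.
by case: (leP a.1 z.1) => ha; case: (leP b.1 z.1).
Qed.

Lemma segC a b z : seg a b z -> seg b a z.
Proof.
move=> [t /andP[t0 t1] ->]; exists (1 - t); first by apply/andP; split; lra.
by rewrite /padd /pscale /=; congr pair; ring.
Qed.

Lemma seg_left a b : seg a b a.
Proof.
exists 0; first by rewrite lexx ler01.
by rewrite /padd /pscale; case: a => ? ? /=; congr pair; ring.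
Qed.

Lemma seg_right a b : seg a b b.
Proof. exact/segC/seg_left. Qed.

(** Away from the vertical lines through a and b every test in [crosses] is stable near z. If z is
    straight below one end, the test on that end may flip, and [jump] records exactly this flip;
    straight above one end, the edge is uncrossed on both sides. *)
Lemma crosses_local a b z : ~ seg a b z ->
  \forall z' \near z,
    crosses a b z (+) crosses a b z' = jump a z z' (+) jump b z z'.
Proof.
wlog le_ab : a b / a.1 <= b.1.
  move=> hw; case: (leP a.1 b.1) => [|/ltW] h nab; first exact: hw.
  have nba : ~ seg b a z by move/segC.
  apply: filterS (hw b a h nba) => z'.
  by rewrite (crossesC a b) (crossesC a b) => ->; rewrite addbC.
move=> nab.
have near1_lt x : x < z.1 -> \forall z' \near z, x < z'.1.
  by move=> h; apply: (cvgr_gt _ cvg_fst).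
have near1_gt x : z.1 < x -> \forall z' \near z, z'.1 < x.
  by move=> h; apply: (cvgr_lt _ cvg_fst).
have near_det0 : det a b z < 0 -> \forall z' \near z, det a b z' < 0.
  by move=> h; apply: (cvgr_lt _ (@det_continuous a b z)).
have near_det1 : 0 < det a b z -> \forall z' \near z, 0 < det a b z'.
  by move=> h; apply: (cvgr_gt _ (@det_continuous a b z)).
case: (ltgtP b.1 z.1) => hb.
- have ha : a.1 < z.1 by exact: le_lt_trans hb.
  near=> z'.
  have h1 : a.1 < z'.1 by near: z'; apply: near1_lt.
  have h2 : b.1 < z'.1 by near: z'; apply: near1_lt.
  by rewrite /crosses /jump (ltW ha) (ltW h1) (ltW hb) (ltW h2) !ltNge
     (ltW hb) (ltW h2).
- case: (ltgtP a.1 z.1) => ha.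
  (* Here z is strictly between the ends in the first coordinate, so a zero determinant would put z
     on the edge. *)
  + have dn0 : det a b z != 0.
      apply/negP => /eqP d0; apply: nab.
      have ba : b.1 - a.1 != 0 by rewrite subr_eq0 gt_eqF// (lt_trans ha).
      exists ((z.1 - a.1) / (b.1 - a.1)).
        apply/andP; split.
          by apply: divr_ge0; rewrite subr_ge0 ?ltW// (lt_trans ha).
        rewrite ler_pdivrMr ?subr_gt0 ?(lt_trans ha)//; lra.
      rewrite /padd /pscale; apply: injective_projections => /=; first by field.
      apply: (mulfI ba); move: d0; rewrite /det => d0.
      transitivity ((b.1 - a.1) * a.2 + (b.2 - a.2) * (z.1 - a.1)); last by field.
      lra.
    have [s0|s1] : det a b z < 0 \/ 0 < det a b z.
      by move: dn0; rewrite neq_lt => /orP[]; [left|right].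
    * near=> z'.
      have h1 : a.1 < z'.1 by near: z'; apply: near1_lt.
      have h2 : z'.1 < b.1 by near: z'; apply: near1_gt.
      have h3 : det a b z' < 0 by near: z'; apply: near_det0.
      by rewrite /crosses /jump (ltW ha) (ltW h1) hb h2 s0 h3 !leNgt hb h2.
    * near=> z'.
      have h1 : a.1 < z'.1 by near: z'; apply: near1_lt.
      have h2 : z'.1 < b.1 by near: z'; apply: near1_gt.
      have h3 : 0 < det a b z' by near: z'; apply: near_det1.
      rewrite /crosses /jump (ltW ha) (ltW h1) hb h2 !leNgt hb h2.
      by rewrite (lt_gtF s1) (lt_gtF h3).
  + near=> z'.
    have h1 : z'.1 < a.1 by near: z'; apply: near1_gt.
    have h2 : z'.1 < b.1 by near: z'; apply: near1_gt.
    by rewrite /crosses /jump !leNgt ha h1 hb h2.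
  + have dE : det a b z = (b.1 - a.1) * (z.2 - a.2).
      by rewrite /det ha subrr mulr0 subr0.
    have ba : 0 < b.1 - a.1 by rewrite subr_gt0 ha.
    case: (ltgtP z.2 a.2) => h.
    * have s0 : det a b z < 0 by rewrite dE pmulr_rlt0// subr_lt0.
      near=> z'.
      have h2 : z'.1 < b.1 by near: z'; apply: near1_gt.
      have h3 : det a b z' < 0 by near: z'; apply: near_det0.
      have hb' : (b.1 <= z.1) = false by rewrite leNgt hb.
      have h2' : (b.1 <= z'.1) = false by rewrite leNgt h2.
      rewrite /crosses /jump hb h2 s0 h3 h hb' h2' ha lexx /=.
      by case: ifP.
    * have s1 : 0 < det a b z by rewrite dE pmulr_rgt0// subr_gt0.
      near=> z'.
      have h2 : z'.1 < b.1 by near: z'; apply: near1_gt.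
      have h3 : 0 < det a b z' by near: z'; apply: near_det1.
      have hb' : (b.1 <= z.1) = false by rewrite leNgt hb.
      have h2' : (b.1 <= z'.1) = false by rewrite leNgt h2.
      rewrite /crosses /jump hb' h2' (lt_gtF s1) (lt_gtF h3) (lt_gtF h) !andbF.
      by rewrite ha lexx; case: ifP.
    * exfalso; apply: nab; suff -> : z = a by exact: seg_left.
      by apply: injective_projections; rewrite ?ha.
- case: (ltgtP a.1 z.1) => ha; last first.
  (* The edge is vertical and lies over z: since z is off it, z is below both ends or above both,
     and the two jumps cancel. *)
  + have hJ : (z.2 < a.2) = (z.2 < b.2).
      apply/idP/idP => h; rewrite ltNge; apply/negP => h'; apply: nab.
        have ab : 0 < a.2 - b.2 by lra.
        have abn : a.2 - b.2 != 0 by rewrite gt_eqF.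
        exists ((a.2 - z.2) / (a.2 - b.2)).
          rewrite divr_ge0 ?(ltW ab)//=; last by lra.
          by rewrite ler_pdivrMr//; lra.
        apply: injective_projections => /=; first by rewrite ha hb; ring.
        by field.
      have ab : 0 < b.2 - a.2 by lra.
      have abn : b.2 - a.2 != 0 by rewrite gt_eqF.
      exists ((z.2 - a.2) / (b.2 - a.2)).
        rewrite divr_ge0 ?(ltW ab)//=; last by lra.
        by rewrite ler_pdivrMr//; lra.
      apply: injective_projections => /=; first by rewrite ha hb; ring.
      by field.
    near=> z'.
    rewrite /jump hJ ha hb; rewrite addbb /crosses ha hb lexx ltxx /=.
    by case: leP.
  + by move: le_ab; rewrite hb leNgt ha.
  + have dE : det a b z = (b.1 - a.1) * (z.2 - b.2).
      by rewrite /det hb; ring.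
    have ba : 0 < b.1 - a.1 by rewrite subr_gt0 hb.
    case: (ltgtP z.2 b.2) => h.
    * have s0 : det a b z < 0 by rewrite dE pmulr_rlt0// subr_lt0.
      near=> z'.
      have h2 : a.1 < z'.1 by near: z'; apply: near1_lt.
      have h3 : det a b z' < 0 by near: z'; apply: near_det0.
      rewrite /crosses /jump (ltW ha) (ltW h2) h3 h hb lexx ltxx /= ltNge.
      by rewrite !andbT.
    * have s1 : 0 < det a b z by rewrite dE pmulr_rgt0// subr_gt0.
      near=> z'.
      have h2 : a.1 < z'.1 by near: z'; apply: near1_lt.
      have h3 : 0 < det a b z' by near: z'; apply: near_det1.
      by rewrite /crosses /jump (ltW ha) (ltW h2) (lt_gtF s1) (lt_gtF h3)
        (lt_gtF h) !andbF.
    * exfalso; apply: nab; suff -> : z = b by exact: seg_right.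
      by apply: injective_projections; rewrite ?hb.
Unshelve. all: by end_near. Qed.


Fixpoint avoids a (s : seq pt) z : Prop :=
  if s is b :: s' then ~ seg a b z /\ avoids b s' z else True.

Fixpoint parity a (s : seq pt) z : bool :=
  if s is b :: s' then crosses a b z (+) parity b s' z else false.

(** The jumps at the inner vertices occur twice and telescope away; only the two ends of the walk
    remain. *)
Lemma parity_local a s z : avoids a s z ->
  \forall z' \near z,
    parity a s z (+) parity a s z' = jump a z z' (+) jump (last a s) z z'.
Proof.
elim: s a => [a _|b s IHs a [nab avs]] /=; first by near=> z'; rewrite addbb.
apply: filterS2 (crosses_local nab) (IHs b avs) => z' e1 e2.
by rewrite addbACA e1 e2 addbA addbK.
Unshelve. all: by end_near. Qed.

(** From outside the box of radius M, an upward ray meets an edge only if it starts below the box,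
    and then exactly when z.1 separates the ends of the edge. These conditions telescope along the
    walk, so the parity depends only on its ends. *)
Lemma parity_far a s z (M : R) :
  (forall p, p \in a :: s -> `|p.1| <= M /\ `|p.2| <= M) ->
  M < `|z.1| \/ M < `|z.2| ->
  parity a s z = [&& z.2 < - M, `|z.1| <= M &
                     (a.1 <= z.1) (+) ((last a s).1 <= z.1)].
Proof.
move=> box far; elim: s a box => [a _|b s IHs a box] /=.
  by rewrite addbb !andbF.
rewrite {}IHs; last by move=> p ps; apply: box; rewrite inE ps orbT.
suff -> : crosses a b z =
    [&& z.2 < - M, `|z.1| <= M & (a.1 <= z.1) (+) (b.1 <= z.1)].
  by case: (z.2 < - M) => //=; case: (`|z.1| <= M) => //=; rewrite addbA addbK.
have [a1 a2] := box a (mem_head _ _).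
have [b1 b2] : `|b.1| <= M /\ `|b.2| <= M by apply: box; rewrite !inE eqxx orbT.
case/ler_normlP: a1 => a1 a1'; case/ler_normlP: a2 => a2 a2'.
case/ler_normlP: b1 => b1 b1'; case/ler_normlP: b2 => b2 b2'.
rewrite /crosses.
(* In this form the sign of every factor is known once z is above or below the box and its first
   coordinate is compared with those of the ends. *)
have dE : det a b z =
  (b.1 - z.1) * (z.2 - a.2) + (z.1 - a.1) * (z.2 - b.2) by rewrite /det; ring.
have [z1|z1] := boolP (`|z.1| <= M); last first.
  rewrite /= andbF; move: z1; rewrite -ltNge lter_normr orbC => /orP[] z1.
    have -> : (a.1 <= z.1) = false by apply/negbTE; rewrite -ltNge; lra.
    by have -> : (b.1 <= z.1) = false by apply/negbTE; rewrite -ltNge; lra.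
  have -> : a.1 <= z.1 by lra.
  by have -> : (z.1 < b.1) = false by apply/negbTE; rewrite -leNgt; lra.
have {far} : M < `|z.2| by case: far => //; rewrite ltNge z1.
rewrite lter_normr orbC => /orP[] z2.
  have -> : z.2 < - M by lra.
  have az : 0 < a.2 - z.2 by lra.
  have bz : 0 < b.2 - z.2 by lra.
  rewrite /= dE; case: (leP a.1 z.1) => h1; case: (leP b.1 z.1) => h2 //=.
    have p1 : 0 < (b.1 - z.1) * (a.2 - z.2) by apply: mulr_gt0; lra.
    have p2 : 0 <= (z.1 - a.1) * (b.2 - z.2) by apply: mulr_ge0; lra.
    by nra.
  have p1 : 0 <= (z.1 - b.1) * (a.2 - z.2) by apply: mulr_ge0; lra.
  have p2 : 0 < (a.1 - z.1) * (b.2 - z.2) by apply: mulr_gt0; lra.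
  by nra.
have -> /= : (z.2 < - M) = false by apply/negbTE; rewrite -leNgt; lra.
have az : 0 < z.2 - a.2 by lra.
have bz : 0 < z.2 - b.2 by lra.
case: (leP a.1 z.1) => h1; case: (leP b.1 z.1) => h2 //=;
  apply/negbTE; rewrite -leNgt dE.
  by apply: addr_ge0; apply: mulr_ge0; lra.
rewrite -oppr_ge0 opprD -!mulNr !opprB.
by apply: addr_ge0; apply: mulr_ge0; lra.
Qed.

End Plane.

(** * Non-edges surrounded by two walks *)

Lemma connected_locally_constant (T : topologicalType) (A : set T)
    (g : T -> bool) x y :
  connected A -> (forall z, A z -> \forall z' \near z, g z' = g z) ->
  A x -> A y -> g x = g y.
Proof.
move=> cA gloc Ax Ay.
(* This level set of g is relatively open and relatively closed in A. *)
pose B := [set z | A z /\ g z = g x].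
suff BA : B = A by move: Ay; rewrite -BA => -[_ ->].
apply: cA; first by exists x.
- exists (interior [set z | g z = g x]); first exact: open_interior.
  apply/seteqP; split => z [Az gz]; split => //.
    by near=> z'; rewrite /= -gz; near: z'; exact: gloc.
  by have /nbhs_singleton := gz.
- exists (~` interior [set z | g z != g x]).
    exact/open_closedC/open_interior.
  apply/seteqP; split => z [Az gz]; split => //.
    by move=> /nbhs_singleton /=; rewrite gz eqxx.
  apply/eqP/negPn/negP => ngz; apply: gz.
  by near=> z'; rewrite /=; suff -> : g z' = g z by []; near: z'; exact: gloc.
Unshelve. all: by end_near. Qed.

Section Enclosure.
Variable R : realType.
Local Notation pt := (R * R)%type.
Implicit Types a b c u v w z : pt.

(* Coordinates adapted to the line uv: signed distance to it, and position
   along it, both up to the factor |v - u|. *)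
Definition frame u v z : pt :=
  (det u v z, (v.1 - u.1) * (z.1 - u.1) + (v.2 - u.2) * (z.2 - u.2)).

Lemma frame_continuous u v : continuous (frame u v).
Proof.
move=> z.
have h1 : det u v y @[y --> z] --> det u v z by exact: det_continuous.
have h2 : (v.1 - u.1) * (y.1 - u.1) + (v.2 - u.2) * (y.2 - u.2) @[y --> z]
    --> (v.1 - u.1) * (z.1 - u.1) + (v.2 - u.2) * (z.2 - u.2).
  apply: cvgD; apply: cvgM; try exact: cvg_cst.
  - by apply: cvgB; [exact: cvg_fst|exact: cvg_cst].
  - by apply: cvgB; [exact: cvg_snd|exact: cvg_cst].
exact: (cvg_pair h1 h2).
Qed.

Definition sqdist u v : R := (v.1 - u.1) ^+ 2 + (v.2 - u.2) ^+ 2.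

Lemma sqdist_gt0 u v : u != v -> 0 < sqdist u v.
Proof.
move=> nuv; rewrite lt_def addr_ge0 ?sqr_ge0// andbT.
apply: contra nuv; rewrite paddr_eq0 ?sqr_ge0// !sqrf_eq0 !subr_eq0.
by move=> /andP[/eqP e1 /eqP e2]; apply/eqP/injective_projections.
Qed.

(** Up to a translation, [frame u v] is a reflection followed by scaling by |v - u|; its linear part
    is symmetric, so its inverse is itself divided by the squared length. *)
Lemma frame_inv u v z : u != v ->
  z = (u.1 + ((v.1 - u.1) * (frame u v z).2 - (v.2 - u.2) * (frame u v z).1)
             / sqdist u v,
       u.2 + ((v.2 - u.2) * (frame u v z).2 + (v.1 - u.1) * (frame u v z).1)
             / sqdist u v).
Proof.
move=> /sqdist_gt0/lt0r_neq0; rewrite /frame /det /sqdist /= => n0.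
by apply: injective_projections => /=; field.
Qed.

Lemma frame_seg u v a b z : u != v ->
  seg (frame u v a) (frame u v b) (frame u v z) -> seg a b z.
Proof.
move=> nuv [t t01 e]; exists t => //.
have s0 := lt0r_neq0 (sqdist_gt0 nuv).
move: (frame_inv a nuv) (frame_inv b nuv) (frame_inv z nuv); rewrite e.
move: (frame u v a) (frame u v b) => fa fb -> -> ->.
by apply: injective_projections => /=; field.
Qed.

Fixpoint walk_in (D : set pt) a (s : seq pt) : Prop :=
  if s is b :: s' then seg a b `<=` D /\ walk_in D b s' else True.

Lemma walk_avoids u v D a s z : u != v -> walk_in D a s -> ~ D z ->
  avoids (frame u v a) (map (frame u v) s) (frame u v z).
Proof.
move=> nuv + nDz; elim: s a => [//|b s IHs] a [abD wD] /=; split; last exact: IHs.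
by move=> /(frame_seg nuv)/abD.
Qed.

(** By the half-open convention, vertices on the vertical line through z count as lying to its left,
    so no edge here changes sides. *)
Lemma parity_left a s z : (forall p, p \in a :: s -> p.1 <= z.1) ->
  parity a s z = false.
Proof.
elim: s a => [//|b s IHs] a h /=; rewrite IHs; last first.
  by move=> p ps; apply: h; rewrite inE ps orbT.
by rewrite /crosses h ?mem_head// ltNge h// !inE eqxx orbT.
Qed.

(* Seen from a point of the open segment uv, looking along it towards v, a walk
   through the open left half-plane is crossed exactly once: at v. *)
Lemma parity_right u v s z : u.1 = z.1 -> v.1 = z.1 -> u.2 < z.2 -> z.2 < v.2 ->
  s != [::] -> (forall p, p \in s -> z.1 < p.1) ->
  parity u (rcons s v) z = true.
Proof.
move=> u1 v1 u2 v2.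
have tail a s' : (forall p, p \in a :: s' -> z.1 < p.1) ->
    parity a (rcons s' v) z = true.
  elim: s' a => [|b s' IHs] a h /=.
    have za : z.1 < a.1 by apply: h; rewrite mem_head.
    rewrite /crosses leNgt za /= v1 lexx /= addbF /det v1.
    rewrite (_ : _ - _ = (a.1 - z.1) * (v.2 - z.2)); last by ring.
    by rewrite mulr_gt0// subr_gt0.
  rewrite IHs; last by move=> p ps; apply: h; rewrite inE ps orbT.
  by rewrite /crosses !leNgt !h ?inE ?eqxx ?orbT.
case: s => [//|b s] _ h /=; rewrite tail//.
have zb : z.1 < b.1 by apply: h; rewrite mem_head.
rewrite /crosses u1 lexx zb /= /det u1 subrr mulr0 subr0.
by rewrite ltNge ltW// mulr_gt0// subr_gt0.
Qed.

Lemma seq_bounded (s : seq pt) :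
  exists2 M : R, 0 <= M & forall p, p \in s -> `|p.1| <= M /\ `|p.2| <= M.
Proof.
elim: s => [|a s [M M0 hM]]; first by exists 0.
exists (M + `|a.1| + `|a.2|); first by rewrite !addr_ge0.
have h1 : 0 <= `|a.1| by []. have h2 : 0 <= `|a.2| by [].
move=> p; rewrite inE => /orP[/eqP ->|/hM[p1 p2]]; split; lra.
Qed.

(** In the frame of uv, add the crossing parities of the two walks. The sum is locally constant off
    D, since the walks share their ends; it is true at z and false far away. Hence the component of
    z stays in a box of the frame, and so is bounded. *)
Lemma enclosed (D : set pt) u v l r z :
  l != [::] ->
  walk_in D u (rcons l v) -> walk_in D u (rcons r v) ->
  (forall p, p \in l -> 0 < det u v p) ->
  (forall p, p \in r -> det u v p < 0) ->
  D u -> D v -> seg u v z -> ~ D z ->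
  bounded_pt (connected_component (~` D) z).
Proof.
move=> l0 wl wr hl hr Du Dv [t /andP[t0 t1] zE] nDz.
have nuv : u != v.
  case: l l0 hl {wl} => [//|p l] _ hl; apply/negP => /eqP e.
  by have := hl p (mem_head _ _); rewrite e /det !subrr !mul0r subrr ltxx.
(* Both ends of uv belong to D, so z is strictly between them. *)
have t0' : 0 < t.
  rewrite lt_def t0 andbT; apply/negP => /eqP e; apply: nDz.
  by rewrite zE e /padd /pscale /= subr0 !mul1r !mul0r !addr0 -surjective_pairing.
have t1' : t < 1.
  rewrite lt_def t1 andbT; apply/negP => /eqP e; apply: nDz.
  rewrite zE -e /padd /pscale /= subrr !mul1r !mul0r !add0r.
  by rewrite -surjective_pairing.
have s0 := sqdist_gt0 nuv.
pose f := frame u v; pose w s z := parity (f u) (map f (rcons s v)) (f z).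
pose g z := w l z (+) w r z.
have fu : f u = (0, 0).
  by rewrite /f /frame /det !subrr !mulr0 subrr addr0.
have fv : f v = (0, sqdist u v).
  by rewrite /f /frame /det mulrC subrr -!expr2.
have fz : f z = (0, t * sqdist u v).
  rewrite zE /f /frame /det /padd /pscale /sqdist /=.
  by congr pair; ring.
(* The ray from z towards v crosses the walk through [l] once, and the walk through [r] never. *)
have gz : g z = true.
  rewrite /g /w !map_rcons parity_right ?parity_left ?fu ?fv ?fz //=.
  - move=> p; rewrite inE mem_rcons inE => /or3P[/eqP->//|/eqP->//|].
    by move=> /mapP[q /hr hq ->]; exact: ltW.
  - by rewrite mulr_gt0.
  - by rewrite gtr_pMl.
  - by case: (l) l0.
  - by move=> p /mapP[q /hl hq ->].
(* Both walks jump only at [f u] and [f v], by the same amounts, which cancel in g. *)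
have gloc z0 : (~` D) z0 -> \forall z' \near z0, g z' = g z0.
  move=> nD0.
  have loc s : walk_in D u (rcons s v) -> \forall z' \near z0,
      w s z0 (+) w s z' = jump (f u) (f z0) (f z') (+) jump (f v) (f z0) (f z').
    move=> ws; have := parity_local (walk_avoids nuv ws nD0).
    rewrite map_rcons last_rcons => h.
    rewrite /w !map_rcons.
    exact: (@frame_continuous u v z0 _ h).
  apply: filterS2 (loc l wl) (loc r wr) => z' <-; rewrite /g.
  by case: (w l z0); case: (w l z'); case: (w r z0); case: (w r z').
have [M M0 hM] := seq_bounded (f u :: map f (rcons l v) ++ map f (rcons r v)).
pose A := connected_component (~` D) z.
have Az : A z by apply: connected_component_refl.
have cA : connected A by exact: component_connected.
have AD : A `<=` ~` D by exact: connected_component_sub.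
have box p : A p -> `|(f p).1| <= M /\ `|(f p).2| <= M.
  move=> Ap; have gp : g p = true.
    by rewrite -gz; apply: connected_locally_constant cA _ Ap Az => q /AD/gloc.
  have [//|] := pselect (`|(f p).1| <= M /\ `|(f p).2| <= M).
  move=> /not_andP far; exfalso.
  have {}far : M < `|(f p).1| \/ M < `|(f p).2|.
    by case: far => /negP; rewrite -ltNge => h; apply/orP; rewrite h ?orbT.
  move: gp; rewrite /g /w !(@parity_far _ _ _ _ M)//.
  (* Outside the box both parities are given by the same formula in the common ends. *)
  - by rewrite !map_rcons !last_rcons addbb.
  - move=> q; rewrite inE => qs; apply: hM; rewrite inE mem_cat.
    by case/orP: qs => ->; rewrite ?orbT.
  - move=> q; rewrite inE => qs; apply: hM; rewrite inE mem_cat.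
    by case/orP: qs => ->; rewrite ?orbT.
pose d1 : R := `|v.1 - u.1|; pose d2 : R := `|v.2 - u.2|.
exists (`|u.1| + `|u.2| + (d1 * M + d2 * M) / sqdist u v) => p /box[p1 p2].
(* The box is pulled back through [frame_inv], one coordinate at a time. *)
have key (a b c x y : R) : `|x| <= M -> `|y| <= M ->
    `|c + (a * x + b * y) / sqdist u v| <=
    `|c| + (`|a| * M + `|b| * M) / sqdist u v.
  move=> xM yM; apply: (le_trans (ler_normD _ _)); rewrite lerD2l.
  rewrite normrM [`|_^-1|]gtr0_norm ?invr_gt0// ler_pM2r ?invr_gt0//.
  apply: (le_trans (ler_normD _ _)); rewrite !normrM.
  by apply: lerD; apply: ler_wpM2l.
have u1 : 0 <= `|u.1| :> R by []. have u2 : 0 <= `|u.2| :> R by [].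
rewrite (frame_inv p nuv) -/f /=; split.
  have := key (v.1 - u.1) (- (v.2 - u.2)) u.1 _ _ p2 p1.
  by rewrite normrN mulNr -/d1 -/d2 => h; lra.
have := key (v.2 - u.2) (v.1 - u.1) u.2 _ _ p2 p1.
by rewrite -/d1 -/d2 [_ + d1 * M]addrC => h; lra.
Qed.

End Enclosure.

(** * Orientations of the points of an outside representation *)

Section Chirotope.
Implicit Types (G : rel nat) (P : nat -> nat -> nat -> bool) (n : nat).

(* [P i j k] reads "the points i, j, k form a left turn". The two transitivity
   axioms are Knuth's axioms for CC-systems; the last one forbids a non-edge uv
   to be surrounded by two walks from u to v, one on each side of the line uv. *)
Record obstacle_chirotope G n P : Prop := {
  ch_rot : forall i j k, P i j k -> P j k i;
  ch_anti : forall i j k, P i j k -> ~~ P j i k;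
  ch_total : forall i j k, (i < n)%N -> (j < n)%N -> (k < n)%N ->
    uniq [:: i; j; k] -> P i j k || P j i k;
  ch_trans : forall t s p q r, P t s p -> P t s q -> P t s r ->
    P t p q -> P t q r -> P t p r;
  ch_transC : forall t s p q r, P s t p -> P s t q -> P s t r ->
    P t p q -> P t q r -> P t p r;
  ch_open : forall u v l r, (u < n)%N -> (v < n)%N ->
    all (fun i => i < n)%N l -> all (fun i => i < n)%N r ->
    ~~ G u v -> path G u (rcons l v) -> path G u (rcons r v) ->
    all (P u v) l -> all (P v u) r -> False
}.

(** A reflection exchanges the two transitivity axioms, with p, q, r read backwards, and the two
    sides of a surrounded non-edge. *)
Lemma chirotope_mirror G n P :
  obstacle_chirotope G n P -> obstacle_chirotope G n (fun i j k => P j i k).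
Proof.
case=> rot anti tot tr trC op; split.
- by move=> i j k /rot/rot.
- by move=> i j k; exact: anti.
- by move=> i j k hi hj hk u; rewrite orbC; exact: tot.
- move=> t s p q r tsp tsq tsr tpq tqr.
  by apply/rot/rot/(trC t s r q p) => //; apply/rot.
- move=> t s p q r tsp tsq tsr tpq tqr.
  by apply/rot/rot/(tr t s r q p) => //; apply/rot.
- by move=> u v l r hu hv hl hr nuv pl pr al ar; apply: (op u v r l).
Qed.

(** Here [G'] is the subgraph of G induced on the labels listed in s. This serves both to permute
    labels and to pass from ten points to nine. *)
Lemma chirotope_relabel G G' n n' P s :
  obstacle_chirotope G n P -> size s = n' -> uniq s ->
  all (fun i => i < n)%N s ->
  all (fun i => all (fun j => G' i j == G (nth 0%N s i) (nth 0%N s j))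
                    (iota 0 n')) (iota 0 n') ->
  obstacle_chirotope G' n'
    (fun i j k => P (nth 0%N s i) (nth 0%N s j) (nth 0%N s k)).
Proof.
case=> rot anti tot tr trC op sz us sn G'G.
have nthn i : (i < n')%N -> (nth 0%N s i < n)%N.
  by move=> hi; apply: (allP sn); rewrite mem_nth ?sz.
have G'E i j : (i < n')%N -> (j < n')%N ->
    G' i j = G (nth 0%N s i) (nth 0%N s j).
  move=> hi hj; apply/eqP/(allP (allP G'G i _)); by rewrite mem_iota.
have pathE u l : (u < n')%N -> all (fun i => i < n')%N l ->
    path G' u l = path G (nth 0%N s u) (map (nth 0%N s) l).
  elim: l u => [//|a l IHl] u hu /= /andP[ha hl].
  by rewrite G'E// IHl.
have all_rcons v l : (v < n')%N -> all (fun i => i < n')%N l ->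
    all (fun i => i < n')%N (rcons l v).
  by move=> hv hl; rewrite all_rcons hv.
have all_map l : all (fun i => i < n')%N l ->
    all (fun i => i < n)%N (map (nth 0%N s) l).
  by move=> hl; rewrite all_map; apply: sub_all hl => i; exact: nthn.
split.
- by move=> i j k; exact: rot.
- by move=> i j k; exact: anti.
- move=> i j k hi hj hk u; apply: tot; rewrite ?nthn//.
  by move: u; rewrite /= !inE !negb_or !nth_uniq ?sz.
- by move=> t u p q r; exact: tr.
- by move=> t u p q r; exact: trC.
- move=> u v l r hu hv hl hr nuv pl pr al ar.
  apply: (op (nth 0%N s u) (nth 0%N s v) (map (nth 0%N s) l)
            (map (nth 0%N s) r)); rewrite ?nthn//; try exact: all_map.
  + by rewrite -G'E.
  + by rewrite -map_rcons -pathE// all_rcons.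
  + by rewrite -map_rcons -pathE// all_rcons.
  + by rewrite seq.all_map.
  + by rewrite seq.all_map.
Qed.

(** If the common neighbours x and y were on different sides, the walks u x v and u y v would
    surround the non-edge uv. *)
Lemma chirotope_side G n P u v x y :
  obstacle_chirotope G n P -> (u < n)%N -> (v < n)%N -> (x < n)%N ->
  (y < n)%N -> u != v -> [&& u != x, v != x, u != y & v != y] ->
  ~~ G u v -> [&& G u x, G x v, G u y & G y v] -> P u v x = P u v y.
Proof.
case=> rot anti tot _ _ op hu hv hx hy uv /and4P[ux vx uy vy] nG.
move=> /and4P[gux gxv guy gyv].
have flip z : (z < n)%N -> u != z -> v != z -> P v u z = ~~ P u v z.
  move=> hz uz vz; have := tot u v z hu hv hz.
  rewrite /= !inE negb_or uv uz vz => /(_ isT).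
  by case e : (P u v z) => //= _; apply/negbTE/anti.
apply/idP/idP => h; apply/negPn/negP => h'.
  by apply: (op u v [:: x] [:: y]);
     rewrite /= ?andbT ?hx ?hy ?h ?gux ?gxv ?guy ?gyv ?flip ?h'.
by apply: (op u v [:: y] [:: x]);
     rewrite /= ?andbT ?hx ?hy ?h ?gux ?gxv ?guy ?gyv ?flip ?h'.
Qed.

(** * Refutation by unit propagation and branching *)

Definition turn : Type := (nat * nat * nat)%type.

Definition holds P (x : turn) := P x.1.1 x.1.2 x.2.
Definition opp_turn (x : turn) : turn := (x.1.2, x.1.1, x.2).

(** The three rotations of a triple are the same turn; a canonical one lets list membership decide
    whether a turn is known. *)
Definition normal (x : turn) : turn :=
  let: (i, j, k) := x in
  if (i <= j)%N && (i <= k)%N then (i, j, k)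
  else if (j <= i)%N && (j <= k)%N then (j, k, i) else (k, i, j).

(** These are the triples to which [ch_total] applies, so that denying the turn asserts the opposite
    one. *)
Definition labelled n (x : turn) :=
  [&& x.1.1 < n, x.1.2 < n & x.2 < n]%N && uniq [:: x.1.1; x.1.2; x.2].

(** Instances of the transitivity axioms and of [ch_open], read as sets of turns that cannot all
    hold. For transitivity the last turn in such a set is the opposite of the conclusion. *)
Inductive nogood :=
| Trans of nat & nat & nat & nat & nat
| TransC of nat & nat & nat & nat & nat
| Surround of nat & nat & seq nat & seq nat.

Definition turns (g : nogood) : seq turn :=
  match g with
  | Trans t s p q r => [:: (t, s, p); (t, s, q); (t, s, r); (t, p, q); (t, q, r);
                       (p, t, r)]
  | TransC t s p q r => [:: (s, t, p); (s, t, q); (s, t, r); (t, p, q); (t, q, r);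
                       (p, t, r)]
  | Surround u v l r => [seq (u, v, i) | i <- l] ++ [seq (v, u, i) | i <- r]
  end.

Definition legal G n (g : nogood) : bool :=
  if g is Surround u v l r then
    [&& (u < n)%N, (v < n)%N, all (fun i => i < n)%N l, all (fun i => i < n)%N r,
        ~~ G u v, path G u (rcons l v) & path G u (rcons r v)]
  else true.

Lemma nogood_sound G n P g : obstacle_chirotope G n P -> legal G n g ->
  ~~ all (holds P) (turns g).
Proof.
move=> chP; case: g => [t s p q r|t s p q r|u v l r] /= lg; apply/negP.
- move=> /and5P[h1 h2 h3 h4 /and3P[h5 h6 _]].
  by have /negP := ch_anti chP (ch_trans chP h1 h2 h3 h4 h5).
- move=> /and5P[h1 h2 h3 h4 /and3P[h5 h6 _]].
  by have /negP := ch_anti chP (ch_transC chP h1 h2 h3 h4 h5).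
- rewrite all_cat !all_map => /andP[hl hr].
  case/and5P: lg => hu hv hl' hr' /and3P[nuv pl pr].
  exact: (ch_open chP) hl hr.
Qed.

(** A refutation tree: each node first propagates its nogoods in the given order, then a leaf must
    be contradictory and a branch splits on a turn and its opposite. *)
Inductive certificate :=
| Leaf of seq nogood
| Branch of seq nogood & turn & certificate & certificate.

(* One step of unit propagation: if all turns of g but one are known, the
   remaining one is reversed; [None] means that g is violated. *)
Definition derive1 G n (known : seq turn) (g : nogood) : option (seq turn) :=
  if legal G n g then
    match [seq x <- turns g | normal x \notin known] with
    | [::] => None
    | [:: x] => if labelled n x then Some (normal (opp_turn x) :: known)
                else Some known
    | _ => Some known
    end
  else Some known.

Fixpoint derive G n known gs : option (seq turn) :=
  if gs is g :: gs' then
    if derive1 G n known g is Some known' then derive G n known' gs' else None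
  else Some known.

Fixpoint refutes G n known c : bool :=
  match c with
  | Leaf gs => derive G n known gs == None
  | Branch gs x c1 c2 =>
      if derive G n known gs is Some known' then
        [&& labelled n x, refutes G n (normal x :: known') c1
          & refutes G n (normal (opp_turn x) :: known') c2]
      (* Propagation alone has already violated a nogood. *)
      else true
  end.

Lemma holds_normal G n P x : obstacle_chirotope G n P ->
  holds P (normal x) = holds P x.
Proof.
case: x => [[i j] k] chP; rewrite /normal; case: ifP => // _.
have rot a b c : P a b c = P b c a.
  by apply/idP/idP => [|h]; [exact: (ch_rot chP)|apply/(ch_rot chP)/(ch_rot chP)].
by case: ifP => _; rewrite /holds /= rot// rot.
Qed.

Lemma holds_opp G n P x : obstacle_chirotope G n P -> labelled n x ->
  holds P x || holds P (opp_turn x).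
Proof.
by move=> chP /andP[/and3P[? ? ?] u]; exact: (ch_total chP).
Qed.

Lemma derive1_sound G n P known g : obstacle_chirotope G n P ->
  all (holds P) known ->
  if derive1 G n known g is Some known' then all (holds P) known' else false.
Proof.
move=> chP hk; rewrite /derive1; case: ifP => // lg.
have ng := nogood_sound chP lg.
have hin x : normal x \in known -> holds P x.
  by move=> /(allP hk) hx; rewrite -(holds_normal x chP).
case e : [seq x <- turns g | normal x \notin known] => [|x [|y s]] //.
  move/negP: ng; case; apply/allP => x xg; apply: hin.
  apply/negPn/negP => nx; have : x \in [::] by rewrite -e mem_filter nx.
  by [].
case: ifP => // lx; apply/andP; split=> //; rewrite (holds_normal _ chP).
have := holds_opp chP lx; case hx : (holds P x) => //= _.
move/negP: ng; case; apply/allP => y yg.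
case ny : (normal y \in known); first exact: hin.
have : y \in [:: x] by rewrite -e mem_filter ny.
by rewrite inE => /eqP ->.
Qed.

Lemma derive_sound G n P known gs : obstacle_chirotope G n P ->
  all (holds P) known ->
  if derive G n known gs is Some known' then all (holds P) known' else false.
Proof.
move=> chP; elim: gs known => [//|g gs IHg] known hk /=.
by have := derive1_sound g chP hk; case: derive1 => // known'; exact: IHg.
Qed.

Lemma refutes_sound G n P known c : obstacle_chirotope G n P ->
  all (holds P) known -> refutes G n known c -> False.
Proof.
move=> chP; elim: c known => [gs|gs x c1 IH1 c2 IH2] known hk /=.
  by have := derive_sound gs chP hk; case: derive.
have := derive_sound gs chP hk; case: derive => // known' hk'.
move=> /and3P[lx r1 r2]; have := holds_opp chP lx.
have [hx|_ /= hx] := boolP (holds P x).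
  rewrite -(holds_normal x chP) in hx.
  by move=> _; apply: IH1 r1; exact/andP.
rewrite -(holds_normal (opp_turn x) chP) in hx.
by apply: IH2 r2; exact/andP.
Qed.

(* The points p_i = i, q_i = 4 + i (i < 4) and c = 8. *)
Definition adj9 : rel nat := fun i j =>
  [&& i != j, (i.+4 != j) || (j == 8), (j.+4 != i) || (i == 8),
      (i != 8) || (j < 4)%N & (j != 8) || (i < 4)%N].

Local Notation T := Trans.
Local Notation U := TransC.
Local Notation E := Surround.

(* Produced by a DPLL search on the orientations of the nine points. *)
Definition adj9_certificate : certificate :=
  (Branch [:: E 0 4 [:: 3] [:: 7]; E 0 4 [:: 3] [:: 6]; E 0 4 [:: 3] [:: 5];
  E 0 4 [:: 3] [:: 2]; E 0 4 [:: 3] [:: 1]; E 1 5 [:: 3] [:: 7];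
  E 1 5 [:: 3] [:: 6]; E 1 5 [:: 3] [:: 4]; E 1 5 [:: 3] [:: 2];
  E 1 5 [:: 3] [:: 0]; T 1 5 0 4 2; E 2 6 [:: 3] [:: 7]; E 2 6 [:: 3] [:: 5];
  E 2 6 [:: 3] [:: 4]; E 2 6 [:: 3] [:: 1]; E 2 6 [:: 3] [:: 0]; T 2 6 1 5 4;
  T 2 6 0 4 5; U 4 0 2 6 5; U 4 0 1 2 6; U 6 2 0 4 5; U 6 2 0 4 1] (0, 3, 7)
  (Branch [:: E 3 7 [:: 0] [:: 6]; E 3 7 [:: 0] [:: 5]; E 3 7 [:: 0] [:: 4];
  E 3 7 [:: 0] [:: 2]; E 3 7 [:: 0] [:: 1]] (0, 1, 3) (Branch [:: T 0 4 1 3 7;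
  T 1 5 0 4 3; T 3 7 0 1 5; T 0 1 3 7 5; T 3 7 1 5 4; T 5 3 0 4 7] (0, 2, 3)
  (Branch [:: T 0 5 2 3 7; T 2 6 0 5 3; T 2 6 0 4 3; T 3 7 0 2 6; T 2 6 0 1 3;
  T 2 6 0 5 7; T 3 7 2 6 5; T 3 7 2 6 4; T 3 4 1 2 6] (0, 5, 8) (Branch
  [:: E 5 8 [:: 0] [:: 3]; E 5 8 [:: 0] [:: 2]; U 5 3 2 6 8] (0, 2, 8) (Leaf
  [:: T 2 7 0 5 8; T 2 6 0 5 8; T 2 3 0 5 8; E 7 8 [:: 1] [:: 2];
  E 6 8 [:: 3] [:: 5; 2]; E 6 8 [:: 1] [:: 5; 2]; U 3 6 2 8 7; T 3 7 1 2 8;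
  U 8 1 3 7 6; E 7 8 [:: 6; 3] [:: 1]]) (Leaf [:: T 2 0 4 5 8; U 0 2 4 5 8;
  T 2 0 1 5 8; E 4 8 [:: 2] [:: 1]; U 4 0 1 5 8; T 1 5 2 4 8;
  E 5 8 [:: 3] [:: 4; 1]])) (Branch [:: E 5 8 [:: 3] [:: 0];
  E 5 8 [:: 2] [:: 0]; T 5 2 3 8 6; T 5 3 0 8 7] (0, 2, 8) (Leaf
  [:: U 0 7 2 8 5; U 0 6 2 8 5; T 0 4 2 8 5; U 0 3 2 8 5; U 7 5 0 4 8;
  U 7 5 0 1 8; U 6 5 0 4 8; E 6 8 [:: 0] [:: 3]; T 4 6 0 8 3; T 3 7 0 6 8;
  T 8 4 3 6 7; E 7 8 [:: 1] [:: 6; 3]]) (Leaf [:: U 2 5 0 8 7; U 2 5 0 8 6;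
  T 2 6 0 8 3; E 7 8 [:: 2] [:: 1]; E 6 8 [:: 5; 2] [:: 3];
  E 6 8 [:: 5; 2] [:: 1]; T 3 7 2 6 8; T 3 1 2 6 8; T 8 1 3 6 7;
  E 7 8 [:: 1] [:: 6; 3]]))) (Branch [:: T 0 5 2 6 3; T 3 7 0 5 2; T 2 6 0 3 7;
  T 3 7 0 5 6; T 2 6 3 7 5] (0, 5, 8) (Branch [:: E 5 8 [:: 0] [:: 3];
  E 5 8 [:: 0] [:: 2]; U 5 2 3 7 8] (0, 2, 8) (Leaf [:: T 0 5 2 8 7;
  U 7 3 0 5 8; E 7 8 [:: 0] [:: 5; 3]]) (Leaf [:: T 2 0 4 5 8; U 0 2 4 5 8;
  T 2 0 1 5 8; E 4 8 [:: 2] [:: 1]; U 4 0 1 5 8; T 1 5 2 4 8;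
  E 5 8 [:: 3] [:: 4; 1]])) (Branch [:: E 5 8 [:: 3] [:: 0];
  E 5 8 [:: 2] [:: 0]; T 5 3 2 8 7; T 5 3 0 8 6] (0, 2, 8) (Leaf
  [:: U 0 6 2 8 5; T 0 4 2 8 5; T 0 1 2 8 5; U 2 5 0 4 8; U 6 5 0 4 8;
  E 4 8 [:: 1] [:: 6; 0]; U 1 4 0 8 5; T 4 1 2 8 5; E 5 8 [:: 4; 1] [:: 3]])
  (Leaf [:: T 2 0 5 7 8; T 7 2 3 8 5; E 7 8 [:: 5; 3] [:: 2]])))) (Branch
  [:: T 0 4 1 6 3; U 0 6 1 5 3; U 0 6 1 2 3; T 3 7 0 4 1; T 1 5 0 3 7;
  T 1 5 0 3 6; T 1 5 0 3 2; T 0 3 1 6 7; T 6 0 1 5 3; T 3 7 0 4 6; T 0 3 1 5 7;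
  T 3 7 0 4 5; U 5 1 0 3 2; T 0 3 2 7 5; T 3 7 0 4 2; T 1 5 3 7 4; T 4 3 1 5 7;
  T 4 3 1 2 7; T 1 5 0 7 6; T 1 5 0 7 2; T 6 3 1 5 7; T 2 3 1 5 7] (0, 5, 8)
  (Branch [:: E 5 8 [:: 0] [:: 3]; E 5 8 [:: 0] [:: 2]; U 5 3 2 6 8;
  U 5 3 2 4 8] (0, 2, 8) (Leaf [:: T 2 6 0 5 8; E 6 8 [:: 3] [:: 5; 2];
  E 6 8 [:: 0] [:: 5; 2]; T 6 3 5 8 7; U 3 6 5 8 7; T 3 7 4 8 6; T 6 0 3 8 4;
  T 3 7 0 8 6; T 8 6 0 3 7; U 0 6 4 7 8; E 4 8 [:: 6; 0] [:: 3]]) (Leaf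
  [:: T 2 0 5 8 7; T 2 0 4 7 8; U 4 2 5 8 7; U 4 2 3 7 8;
  E 4 8 [:: 2] [:: 3]])) (Branch [:: E 5 8 [:: 3] [:: 0]; E 5 8 [:: 2] [:: 0];
  T 5 2 3 8 6; T 5 6 3 8 4] (0, 2, 8) (Leaf [:: U 0 6 2 8 5; T 0 4 2 8 5;
  T 8 5 0 6 4; T 4 3 0 8 5; E 4 8 [:: 3] [:: 6; 0]]) (Leaf [:: U 2 5 0 8 6;
  E 6 8 [:: 5; 2] [:: 3]; E 6 8 [:: 5; 2] [:: 0]; T 3 7 5 6 8; U 3 4 5 6 8;
  U 3 0 5 6 8; U 6 5 3 7 8; U 8 6 0 7 3; U 6 3 0 4 8; T 0 4 6 8 7;
  E 4 8 [:: 3] [:: 6; 0]])))) (Branch [:: E 3 7 [:: 6] [:: 0];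
  E 3 7 [:: 5] [:: 0]; E 3 7 [:: 4] [:: 0]; E 3 7 [:: 2] [:: 0];
  E 3 7 [:: 1] [:: 0]] (0, 1, 3) (Branch [:: T 1 5 0 7 3; T 1 5 0 4 3;
  U 3 7 0 1 5; T 1 5 0 4 7; T 7 3 0 1 5; U 3 7 1 5 4] (0, 2, 3) (Branch
  [:: T 2 6 0 7 3; T 2 6 0 4 3; T 2 6 0 5 7; T 2 6 0 4 7] (1, 4, 8) (Branch
  [:: E 4 8 [:: 1] [:: 3]; E 4 8 [:: 1] [:: 2]; U 4 3 2 7 8; U 4 3 1 5 8]
  (0, 5, 8) (Leaf [:: U 5 1 0 4 8; E 5 8 [:: 0] [:: 4; 1]]) (Leaf
  [:: E 5 8 [:: 3] [:: 0]; E 5 8 [:: 2] [:: 0]; T 3 4 5 7 8; U 2 5 4 8 7;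
  E 7 8 [:: 2] [:: 4; 3]])) (Branch [:: E 4 8 [:: 3] [:: 1];
  E 4 8 [:: 2] [:: 1]; T 4 2 3 8 7; T 4 1 3 8 5] (0, 5, 8) (Leaf
  [:: E 5 8 [:: 0] [:: 3]; E 5 8 [:: 0] [:: 2]; U 3 7 4 5 8; T 2 7 4 5 8;
  E 7 8 [:: 4; 3] [:: 2]]) (Leaf [:: T 5 0 1 8 4; E 5 8 [:: 4; 1] [:: 0]])))
  (Branch [:: T 0 5 2 7 3; T 0 5 2 6 3; T 0 5 2 6 7; U 3 7 0 4 6; U 3 7 0 1 6;
  T 7 3 0 5 6; U 7 5 0 1 6] (0, 6, 8) (Branch [:: E 6 8 [:: 0] [:: 3];
  E 6 8 [:: 0] [:: 1]; U 6 3 1 7 8; U 6 3 0 4 8] (0, 1, 8) (Leaf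
  [:: U 1 0 6 8 7; U 7 1 3 6 8; E 7 8 [:: 1] [:: 6; 3]]) (Leaf [:: T 0 4 1 6 8;
  E 4 8 [:: 3] [:: 6; 0]; E 4 8 [:: 1] [:: 6; 0]; T 3 6 4 7 8; U 1 4 6 8 7;
  E 7 8 [:: 1] [:: 6; 3]])) (Branch [:: E 6 8 [:: 3] [:: 0];
  E 6 8 [:: 1] [:: 0]; T 6 1 3 8 7; T 6 0 3 8 4] (0, 1, 8) (Leaf
  [:: U 0 6 1 8 4; E 4 8 [:: 6; 0] [:: 3]; E 4 8 [:: 6; 0] [:: 1]; U 3 7 4 8 6;
  T 1 7 4 8 6; E 7 8 [:: 6; 3] [:: 1]]) (Leaf [:: U 0 6 1 7 8; T 7 3 0 8 6;
  E 7 8 [:: 6; 3] [:: 0]])))) (Branch [:: T 0 4 1 7 3; T 0 4 1 6 3;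
  U 0 6 1 5 3; U 0 6 1 2 3; T 1 5 0 3 6; T 0 4 1 6 7; U 0 6 1 5 7; U 0 6 1 2 7;
  T 6 0 1 5 3; U 5 1 0 3 2; T 2 0 3 5 7] (0, 5, 8) (Branch
  [:: E 5 8 [:: 0] [:: 3]; E 5 8 [:: 0] [:: 2]; U 5 3 2 7 8; U 5 3 2 6 8]
  (0, 2, 8) (Leaf [:: T 2 6 0 5 8; E 6 8 [:: 3] [:: 5; 2];
  E 6 8 [:: 0] [:: 5; 2]; T 3 5 6 7 8; U 0 6 5 8 7; E 7 8 [:: 0] [:: 5; 3]])
  (Leaf [:: T 2 0 5 8 7; U 7 2 3 5 8; E 7 8 [:: 2] [:: 5; 3]])) (Branch
  [:: E 5 8 [:: 3] [:: 0]; E 5 8 [:: 2] [:: 0]; T 5 2 3 8 7; T 5 2 3 8 6]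
  (0, 2, 8) (Leaf [:: T 0 7 2 8 5; T 7 3 0 8 5; E 7 8 [:: 5; 3] [:: 0]]) (Leaf
  [:: U 2 5 0 8 6; E 6 8 [:: 5; 2] [:: 3]; E 6 8 [:: 5; 2] [:: 0]; U 3 7 5 6 8;
  T 0 7 5 6 8; E 7 8 [:: 5; 3] [:: 0]]))))).

(** The certificate also assumes that 0, 1, 2 turn left. Otherwise exchange 1 with 2 and 5 with 6:
    this automorphism of [adj9] reverses that turn and permutes the three others. *)
Lemma adj9_no_three_equal P : obstacle_chirotope adj9 9 P ->
  ~ [&& P 0 4 3, P 1 5 3 & P 2 6 3]%N.
Proof.
have oriented Q : obstacle_chirotope adj9 9 Q ->
    Q 0 1 2 -> [&& Q 0 4 3, Q 1 5 3 & Q 2 6 3] -> False.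
  move=> chQ h012 /and3P[h0 h1 h2].
  pose known : seq turn := [:: (0, 1, 2); (0, 4, 3); (1, 5, 3); (2, 6, 3)].
  apply: (@refutes_sound adj9 9 Q known adj9_certificate chQ).
    by rewrite /= /holds /= h012 h0 h1 h2.
  by vm_compute.
move=> chP h; case/and3P: (h) => h0 h1 h2.
have [/oriented|] := boolP (P 0 1 2)%N; first exact.
have := ch_total chP (i := 0) (j := 1) (k := 2) isT isT isT isT.
case: (P 0 1 2)%N => //= h102 _.
have chQ := @chirotope_relabel _ adj9 _ 9 _ [:: 0; 2; 1; 3; 4; 6; 5; 7; 8]%N chP
  erefl isT isT isT.
apply: oriented chQ _ _ => /=; last by rewrite h0 h1 h2.
exact: (ch_rot chP) h102.
Qed.

End Chirotope.

(* p_i = i, q_i = 4 + i (i < 4), c = 8, d = 9. *)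
Definition nonedges : seq (nat * nat) :=
  [:: (0, 4); (1, 5); (2, 6); (3, 7);
      (8, 4); (8, 5); (8, 6); (8, 7); (9, 0); (9, 1); (9, 2); (9, 7); (8, 9)]%N.

Definition adj10 : rel nat := fun i j =>
  [&& i != j, (i, j) \notin nonedges & (j, i) \notin nonedges].

Lemma adj10_sym : symmetric adj10.
Proof. by move=> i j; rewrite /adj10 eq_sym; congr (_ && _); exact: andbC. Qed.

(* Exchanging p_i and q_i for i < 3 turns d into a vertex of the same kind as c;
   [o i] is the side of p_i q_i on which the other p's and q's lie. *)
Lemma adj10_no_chirotope P : obstacle_chirotope adj10 10 P -> False.
Proof.
move=> chP.
have neq3 Q s : obstacle_chirotope adj10 10 Q -> size s = 9%N -> uniq s ->
    all (fun i => i < 10)%N s ->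
    all (fun i => all (fun j => adj9 i j == adj10 (nth 0%N s i) (nth 0%N s j))
                      (iota 0 9)) (iota 0 9) ->
    ~ let P' i j k := Q (nth 0%N s i) (nth 0%N s j) (nth 0%N s k) in
      [&& P' 0%N 4%N 3%N, P' 1%N 5%N 3%N & P' 2%N 6%N 3%N].
  move=> chQ h1 h2 h3 h4.
  exact: adj9_no_three_equal (chirotope_relabel chQ h1 h2 h3 h4).
have tot i j k : (i < 10)%N -> (j < 10)%N -> (k < 10)%N ->
    uniq [:: i; j; k] -> P j i k = ~~ P i j k.
  move=> hi hj hk u; have := ch_total chP hi hj hk u.
  by case e : (P i j k) => //= _; exact/negbTE/(ch_anti chP).
pose p s i := P (nth 0%N s i) (nth 0%N s i.+4) (nth 0%N s 3).
(* Three true values are excluded by [neq3] directly, three false ones by [neq3] for the mirror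
   image. *)
have nae s : size s = 9%N -> uniq s -> all (fun i => i < 10)%N s ->
    all (fun i => all (fun j => adj9 i j == adj10 (nth 0%N s i) (nth 0%N s j))
                      (iota 0 9)) (iota 0 9) ->
    ~~ ((p s 0%N == p s 1%N) && (p s 1%N == p s 2%N)).
  move=> h1 h2 h3 h4; apply/negP => /andP[/eqP e1 /eqP e2].
  have pC i : (i < 3)%N ->
      P (nth 0%N s i.+4) (nth 0%N s i) (nth 0%N s 3) = ~~ p s i.
    move=> hi; have hi9 : (i.+4 < 9)%N by apply: (@leq_trans 7).
    have lt m : (m < 9)%N -> (nth 0%N s m < 10)%N.
      by move=> hm; apply: (allP h3); rewrite mem_nth ?h1.
    apply: tot; rewrite ?lt ?(ltn_trans hi)//=.
    by rewrite !inE !nth_uniq ?h1 ?(ltn_trans hi)//; case: (i) hi => [|[|[|]]].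
  have [p0|np] := boolP (p s 0%N).
    apply: (neq3 _ s chP h1 h2 h3 h4) => /=.
    rewrite -/(p s 0%N) -/(p s 1%N) -/(p s 2%N).
    by rewrite -e2 -e1 p0.
  apply: (neq3 _ s (chirotope_mirror chP) h1 h2 h3 h4) => /=.
  by rewrite (pC 0%N)// (pC 1%N)// (pC 2%N)// -e2 -e1 np.
have side i x y : (i < 4)%N -> x \in iota 0 8 -> y \in iota 0 8 ->
    i != x -> i.+4 != x -> i != y -> i.+4 != y -> P i i.+4 x = P i i.+4 y.
  rewrite !mem_iota !add0n => /= hi hx hy; move: hi hx hy.
  case: i => [|[|[|[|//]]]] _;
  case: x => [|[|[|[|[|[|[|[|//]]]]]]]] _;
  case: y => [|[|[|[|[|[|[|[|//]]]]]]]] _ //= _ _ _ _;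
  exact: (chirotope_side chP).
have flip i x : (i < 4)%N -> x \in iota 0 8 -> i != x -> i.+4 != x ->
    P i.+4 i x = ~~ P i i.+4 x.
  rewrite mem_iota add0n => /= hi hx; move: hi hx.
  case: i => [|[|[|[|//]]]] _;
  by case: x => [|[|[|[|[|[|[|[|//]]]]]]]] _ //= _ _; apply: tot.
pose o i := P i i.+4 (if i == 0 then 1 else 0)%N.
have oE i x : (i < 4)%N -> x \in iota 0 8 -> i != x -> i.+4 != x ->
    P i i.+4 x = o i.
  by move=> hi hx ix ix4; apply: side => //; case: (i) hi => [|[|[|[|]]]].
have oC i x : (i < 4)%N -> x \in iota 0 8 -> i != x -> i.+4 != x ->
    P i.+4 i x = ~~ o i.
  by move=> hi hx ix ix4; rewrite flip// oE.
(* The four labellings ending in 8 force the values of o to split two and two. Then two indices i, j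
   below 3 have the value opposite to [o 3], which the labelling ending in 9 for i, j, 3 forbids. *)
have := nae [:: 0; 1; 2; 3; 4; 5; 6; 7; 8]%N erefl isT isT isT.
have := nae [:: 0; 1; 3; 2; 4; 5; 7; 6; 8]%N erefl isT isT isT.
have := nae [:: 0; 2; 3; 1; 4; 6; 7; 5; 8]%N erefl isT isT isT.
have := nae [:: 1; 2; 3; 0; 5; 6; 7; 4; 8]%N erefl isT isT isT.
have := nae [:: 4; 5; 3; 6; 0; 1; 7; 2; 9]%N erefl isT isT isT.
have := nae [:: 4; 6; 3; 5; 0; 2; 7; 1; 9]%N erefl isT isT isT.
have := nae [:: 5; 6; 3; 4; 1; 2; 7; 0; 9]%N erefl isT isT isT.
rewrite /p /= !oE// !oC//.
by case: (o 0%N); case: (o 1%N); case: (o 2%N); case: (o 3%N).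
Qed.

(** * From outside representations to chirotopes *)

Section OutsideChirotope.
Variable R : realType.
Local Notation pt := (R * R)%type.

Lemma det_rot (a b c : pt) : det a b c = det b c a.
Proof. by rewrite /det; ring. Qed.

Lemma det_swap (a b c : pt) : det b a c = - det a b c.
Proof. by rewrite /det; ring. Qed.

Lemma det_eq0 (a b c : pt) : (det a b c == 0) = collinear a b c.
Proof. by rewrite /det /collinear subr_eq0. Qed.

(** The three-term Grassmann-Plücker relation, from which both transitivity axioms follow. *)
Lemma det_plucker (t s p q r : pt) :
  det t s q * det t p r = det t s p * det t q r + det t s r * det t p q.
Proof. by rewrite /det; ring. Qed.

(** For [ch_open], a non-edge meets C in a point z off the drawing. Two surrounding walks would make
    the component of z bounded, but it is the unbounded component containing C. *)
Lemma outside_rep_chirotope n (G : rel nat) (C : set pt) (f : 'I_n.+1 -> pt) :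
  outside_rep (fun u v : 'I_n.+1 => G u v) C f ->
  obstacle_chirotope G n.+1
    (fun i j k => 0 < det (f (inord i)) (f (inord j)) (f (inord k))).
Proof.
move=> [[_ [[finj fgp] [Cf Cadj]]] [x _ [xunb Cx]]].
set D := drawing _ f in xunb Cx.
have nDC z : C z -> ~ D z by move=> /Cx/connected_component_sub.
have Df i : D (f i) by left; exists i.
split=> /=.
- by move=> i j k; rewrite det_rot.
- move=> i j k.
  by rewrite [det (f (inord j)) _ _]det_swap oppr_gt0 -leNgt => /ltW.
- move=> i j k hi hj hk /= /and3P[]; rewrite !inE negb_or => /andP[ij ik] jk _.
  rewrite [det (f (inord j)) _ _]det_swap oppr_gt0 -neq_lt eq_sym det_eq0.
  have inordE a b : (a < n.+1)%N -> (b < n.+1)%N -> a != b ->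
      inord a != inord b :> 'I_n.+1.
    move=> ha hb; apply: contra => /eqP/(congr1 val) /=.
    by rewrite !inordK// => ->.
  by apply: fgp; apply: inordE.
- move=> t s p q r tsp tsq tsr tpq tqr.
  rewrite -(pmulr_rgt0 _ tsq) det_plucker.
  by apply: addr_gt0; apply: mulr_gt0.
- move=> t s p q r; rewrite ![det (f (inord s)) _ _]det_swap !oppr_gt0.
  move=> tsp tsq tsr tpq tqr.
  (* The three determinants with first points t, s are now negative, so both sides of the relation
     change sign. *)
  rewrite -(nmulr_rlt0 _ tsq) det_plucker -oppr_gt0 opprD -!mulNr.
  by apply: addr_gt0; apply: mulr_gt0; rewrite ?oppr_gt0.
- move=> u v l r hu hv hl hr nG pl pr al ar.
  pose g i := f (inord i).
  have walk a s : (a < n.+1)%N -> all (fun i => i < n.+1)%N s -> path G a s ->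
      walk_in D (g a) (map g s).
    elim: s a => [//|b s IHs] a ha /= /andP[hb hs] /andP[Gab ps].
    split; last exact: IHs.
    move=> z abz; right; exists (inord a), (inord b).
    by rewrite !inordK.
  have nuv : u != v.
    apply/negP => /eqP e; subst v; case: l hl pl al => [|i l] hl /=.
      by rewrite andbT (negbTE nG).
    by move=> _ /andP[]; rewrite /det !subrr !mul0r subrr ltxx.
  have inuv : inord u != inord v :> 'I_n.+1.
    by apply: contra nuv => /eqP/(congr1 val) /=; rewrite !inordK// => ->.
  have [z [zuv Cz]] : seg (g u) (g v) `&` C !=set0.
    apply/set0P/negP => /eqP /(Cadj _ _ inuv); rewrite !inordK//.
    by apply/negP.
  apply: xunb; rewrite (same_connected_component (Cx _ Cz)).
  have l0 : l != [::].
    by case: (l) pl => //=; rewrite andbT (negbTE nG).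
  apply: (@enclosed _ D (g u) (g v) (map g l) (map g r)) => //.
  + by case: (l) l0.
  + by rewrite -map_rcons; apply: walk => //; rewrite all_rcons hv.
  + by rewrite -map_rcons; apply: walk => //; rewrite all_rcons hv.
  + by move=> p /mapP[i il ->]; exact: (allP al).
  + move=> p /mapP[i ir ->]; rewrite det_swap oppr_lt0.
    exact: (allP ar).
  + exact: Df.
  + exact: Df.
  + exact: nDC.
Qed.

End OutsideChirotope.

(** * Triangular obstacles *)

Section Triangle.
Variable R : realType.
Local Notation pt := (R * R)%type.
Implicit Types a b c x z : pt.

Lemma seg_connected a b : connected (seg a b).
Proof.
pose h (t : R) : pt := padd (pscale (1 - t) a) (pscale t b).
have -> : seg a b = h @` `[0, 1]%classic.
  apply/seteqP; split => [p [t t01 ->]|p [t + <-]].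
    by exists t => //; rewrite /= in_itv.
  by rewrite /= in_itv /= => t01; exists t.
apply: connected_continuous_connected; first exact: segment_connected.
apply: continuous_subspaceT => t.
have hc u v : (1 - s) * u + s * v @[s --> t] --> (1 - t) * u + t * v.
  apply: cvgD; apply: cvgM; try exact: cvg_cst; last exact: cvg_id.
  by apply: cvgB; [exact: cvg_cst|exact: cvg_id].
exact: (cvg_pair (hc a.1 b.1) (hc a.2 b.2)).
Qed.

Lemma seg_component (A : set pt) a b : seg a b `<=` A ->
  connected_component A a b.
Proof.
move=> abA; apply: (@connected_component_max _ A (seg a b)) => //.
- exact: seg_left.
- exact: seg_connected.
- exact: seg_right.
Qed.

Lemma det_seg a b c d (t : R) :
  det a b (padd (pscale (1 - t) c) (pscale t d)) =
  (1 - t) * det a b c + t * det a b d.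
Proof. by rewrite /det /padd /pscale /=; ring. Qed.

Lemma det_on_seg a b z : seg a b z -> det a b z = 0.
Proof. by move=> [t _ ->]; rewrite det_seg /det; ring. Qed.

(** Along ab the form [det b c] is affine, nonzero at a and zero at b, so it vanishes only at b. *)
Lemma seg_meet a b c z : det a b c != 0 -> seg a b z -> seg b c z -> z = b.
Proof.
move=> n0 [t _ zE] /det_on_seg; rewrite zE det_seg.
have -> : det b c b = 0 by rewrite /det; ring.
rewrite mulr0 addr0 -det_rot => /eqP; rewrite mulf_eq0 (negbTE n0) orbF.
rewrite subr_eq0 => /eqP <-; rewrite /padd /pscale /= subrr !mul0r !mul1r !add0r.
by rewrite -surjective_pairing.
Qed.

Definition triangle a b c : set pt :=
  [set z | [&& 0 < det a b z, 0 < det b c z & 0 < det c a z]].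

(** The three determinants divided by [det a b c] are the barycentric coordinates of z. That of c
    vanishes, and that of b is the parameter along ab. *)
Lemma closed_triangle_side a b c z : 0 < det a b c -> det a b z = 0 ->
  0 <= det b c z -> 0 <= det c a z -> seg a b z.
Proof.
move=> d0 z0 zb za; have dn0 := lt0r_neq0 d0.
have sumE : det b c z + det c a z = det a b c.
  by rewrite -[LHS]add0r -z0 /det; ring.
exists (det c a z / det a b c).
  by rewrite divr_ge0 ?(ltW d0)//= ler_pdivrMr// mul1r -sumE lerDr.
have -> : 1 - det c a z / det a b c = det b c z / det a b c.
  by rewrite -sumE; field; rewrite sumE.
apply: injective_projections; rewrite /padd /pscale /=.
  apply: (mulfI dn0); transitivity (det b c z * a.1 + det c a z * b.1).
    transitivity (det b c z * a.1 + det c a z * b.1 + det a b z * c.1).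
      by rewrite /det; ring.
    by rewrite z0 mul0r addr0.
  by field.
apply: (mulfI dn0); transitivity (det b c z * a.2 + det c a z * b.2).
  transitivity (det b c z * a.2 + det c a z * b.2 + det a b z * c.2).
    by rewrite /det; ring.
  by rewrite z0 mul0r addr0.
by field.
Qed.

(** The triangle is convex, hence a union of segments from one of its points. *)
Lemma triangle_connected a b c : connected (triangle a b c).
Proof.
have [->|/set0P[x Tx]] := eqVneq (triangle a b c) set0; first exact: connected0.
have -> : triangle a b c = \bigcup_(z in triangle a b c) seg x z.
  apply/seteqP; split => [z Tz|z [y Ty [t /andP[t0 t1] ->]]].
    by exists z => //; exact: seg_right.
  have pos (u v : pt) : 0 < det u v x -> 0 < det u v y ->
      0 < det u v (padd (pscale (1 - t) x) (pscale t y)).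
    move=> ux uy; rewrite det_seg; have [->|tn0] := eqVneq t 0.
      by rewrite mul0r subr0 mul1r addr0.
    apply: ltr_wpDl; first by apply: mulr_ge0; [rewrite subr_ge0|exact: ltW].
    by rewrite mulr_gt0// lt_def tn0.
  move: Tx Ty => /and3P[? ? ?] /and3P[? ? ?].
  by apply/and3P; split; apply: pos.
apply: bigcup_connected; first by exists x => y _; exact: seg_left.
by move=> y _; exact: seg_connected.
Qed.

(** A negative form stays negative nearby. If none is negative, all are positive, since a zero one
    would put z on the boundary. *)
Lemma triangle_local a b c z : 0 < det a b c -> ~ polygon_set [:: a; b; c] z ->
  \forall z' \near z,
    [&& 0 < det a b z', 0 < det b c z' & 0 < det c a z'] =
    [&& 0 < det a b z, 0 < det b c z & 0 < det c a z].
Proof.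
move=> d0 nG.
have nab : ~ seg a b z by move=> h; apply: nG; exists 0%N.
have nbc : ~ seg b c z by move=> h; apply: nG; exists 1%N.
have nca : ~ seg c a z by move=> h; apply: nG; exists 2%N.
have near_gt (u v : pt) : 0 < det u v z -> \forall z' \near z, 0 < det u v z'.
  by move=> h; apply: (cvgr_gt _ (@det_continuous _ u v z)).
have near_lt (u v : pt) : det u v z < 0 -> \forall z' \near z, det u v z' < 0.
  by move=> h; apply: (cvgr_lt _ (@det_continuous _ u v z)).
have dbca : 0 < det b c a by rewrite -det_rot.
have dcab : 0 < det c a b by rewrite -det_rot.
case: (ltgtP (det a b z) 0) => h1.
- near=> z'; have h : det a b z' < 0 by near: z'; exact: near_lt.
  by rewrite [in LHS]lt_gtF.
- case: (ltgtP (det b c z) 0) => h2.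
  + near=> z'; have h : det b c z' < 0 by near: z'; exact: near_lt.
    by rewrite [0 < det b c z']lt_gtF// andbF.
  + case: (ltgtP (det c a z) 0) => h3.
    * near=> z'; have h : det c a z' < 0 by near: z'; exact: near_lt.
      by rewrite [0 < det c a z']lt_gtF// !andbF.
    * near=> z'; apply/and3P; split; near: z'; exact: near_gt.
    * by case: nca; apply: (@closed_triangle_side c a b) => //; exact: ltW.
  + have [h3|h3] := ltP (det c a z) 0; last first.
      by case: nbc; apply: (@closed_triangle_side b c a) => //; exact: ltW.
    near=> z'; have h : det c a z' < 0 by near: z'; exact: near_lt.
    by rewrite [0 < det c a z']lt_gtF// !andbF.
- have [h2|h2] := ltP (det b c z) 0.
    near=> z'; have h : det b c z' < 0 by near: z'; exact: near_lt.
    by rewrite [0 < det b c z']lt_gtF// andbF.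
  have [h3|h3] := ltP (det c a z) 0; last first.
    by case: nab; apply: (@closed_triangle_side a b c).
  near=> z'; have h : det c a z' < 0 by near: z'; exact: near_lt.
  by rewrite [0 < det c a z']lt_gtF// !andbF.
Unshelve. all: by end_near. Qed.

Lemma triangle_off_boundary a b c z : triangle a b c z ->
  ~ polygon_set [:: a; b; c] z.
Proof.
move=> /and3P[h1 h2 h3] [[|[|[|//]]] _]; rewrite /pedge /= => /det_on_seg e.
- by move: h1; rewrite e ltxx.
- by move: h2; rewrite e ltxx.
- by move: h3; rewrite e ltxx.
Qed.

Lemma triangle_polygon a b c : 0 < det a b c ->
  simple_closed_polygon [:: a; b; c].
Proof.
move=> d0.
have dabc := lt0r_neq0 d0.
have dbca : det b c a != 0 by rewrite -det_rot.
have dcab : det c a b != 0 by rewrite -det_rot.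
have neq (u v w : pt) : det u v w != 0 -> u != v.
  by apply: contra => /eqP ->; rewrite /det !subrr !mul0r subrr.
have meet (u v w : pt) : det u v w != 0 -> seg u v `&` seg v w = [set v].
  move=> n0; apply/seteqP; split => [z [zuv zvw]|z ->].
    by rewrite (seg_meet n0 zuv zvw).
  by split; [exact: seg_right|exact: seg_left].
split=> //; split.
  by move=> [|[|[|//]]] _ /=; [exact: neq dabc|exact: neq dbca|exact: neq dcab].
move=> [|[|[|//]]] [|[|[|//]]] _ _ //= _; rewrite /pedge /=.
- exact: meet.
- by rewrite setIC meet.
- by rewrite setIC meet.
- exact: meet.
- exact: meet.
- by rewrite setIC meet.
Qed.

(** The triangle is connected, and membership in it is locally constant off the boundary, so it is a
    whole component of the complement. *)
Lemma triangle_obstacle a b c x : 0 < det a b c -> triangle a b c x ->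
  obstacle (triangle a b c).
Proof.
move=> d0 Tx; split.
  rewrite openE => z Tz.
  apply: filterS (triangle_local d0 (triangle_off_boundary Tz)) => z' e.
  by rewrite /triangle /= e.
exists (polygon_set [:: a; b; c]); split.
  by left; exists [:: a; b; c]; split=> //; exact: triangle_polygon.
exists x; first exact: triangle_off_boundary Tx.
apply/seteqP; split.
  apply: connected_component_max => //; last exact: triangle_connected.
  by move=> z /triangle_off_boundary.
move=> z Cz.
have nGx : (~` polygon_set [:: a; b; c]) x by exact: triangle_off_boundary.
pose g y := [&& 0 < det a b y, 0 < det b c y & 0 < det c a y].
have cA : connected (connected_component (~` polygon_set [:: a; b; c]) x).
  exact: component_connected.
have gloc y : connected_component (~` polygon_set [:: a; b; c]) x y ->
    \forall y' \near y, g y' = g y.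
  by move=> /connected_component_sub; exact: triangle_local.
have := connected_locally_constant cA gloc (connected_component_refl nGx) Cz.
by rewrite /triangle /= -/(g z) => <-.
Qed.

End Triangle.

(** * The inside representation *)

(** Listed as p_0 to p_3, q_0 to q_3, c, d. Since q_i = - p_i, every non-edge p_i q_i passes through
    the origin, which is inside the triangle; c and d lie on two of its sides. *)
Definition position : seq (int * int) :=
  [:: (2, 5); (-2, 5); (-5, 2); (-5, -2); (-2, -5); (2, -5); (5, -2); (5, 2);
      (-1, 0); (0, -1)].

Definition corner (i : nat) : int * int :=
  nth (0, 0) [:: (-2, -1); (1, -1); (0, 1)] i.

(** An integer copy of [det], so that the finite checks are decided by computation. *)
Definition detz (a b c : int * int) : int :=
  (b.1 - a.1) * (c.2 - a.2) - (b.2 - a.2) * (c.1 - a.1).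

Definition place (i : nat) : int * int := nth (0, 0) position i.

Definition sidez (m : nat) (p : int * int) : int :=
  detz (corner m) (corner (m.+1 %% 3)%N) p.

(* A segment misses the triangle if some nonnegative combination of the three
   side forms is nonpositive at both ends; it meets the triangle if all three
   forms are positive at some twelfth of it. *)
Arguments sidez : simpl never.

Definition misses (p q : int * int) : bool :=
  has (fun w : nat * nat * nat =>
    let comb r := sidez 0 r * w.1.1%:Z + sidez 1 r * w.1.2%:Z
                  + sidez 2 r * w.2%:Z in
    [&& (0 < w.1.1 + w.1.2 + w.2)%N, comb p <= 0 & comb q <= 0])
  [seq (ij, k) | ij <- [seq (i, j) | i <- iota 0 5, j <- iota 0 5],
                 k <- iota 0 5].

Definition hits (p q : int * int) : bool :=
  has (fun t : nat => all (fun m =>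
      0 < sidez m p * (12 - t)%N%:Z + sidez m q * t%:Z) (iota 0 3))
    (iota 0 12).

Lemma adj10_position :
  all (fun i => all (fun j => (i != j) ==>
    if adj10 i j then misses (place i) (place j) else hits (place i) (place j))
    (iota 0 10)) (iota 0 10).
Proof. by vm_compute. Qed.

Lemma position_general :
  all (fun i => all (fun j => all (fun k => uniq [:: i; j; k] ==>
    (detz (place i) (place j) (place k) != 0)) (iota 0 10)) (iota 0 10))
    (iota 0 10).
Proof. by vm_compute. Qed.

Lemma position_outside :
  all (fun i => has (fun m => sidez m (place i) <= 0) (iota 0 3)) (iota 0 10).
Proof. by vm_compute. Qed.

(** * Transfer of the integer checks to the real plane *)

Section Representation.
Variable R : realType.
Local Notation pt := (R * R)%type.

Definition embed (p : int * int) : pt := (p.1%:~R, p.2%:~R).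

Lemma det_point p q r : det (embed p) (embed q) (embed r) = (detz p q r)%:~R.
Proof. by rewrite /det /detz /= !(rmorphB, rmorphM). Qed.

Definition block : set pt :=
  triangle (embed (corner 0)) (embed (corner 1)) (embed (corner 2)).

Definition side (m : nat) : pt -> R :=
  det (embed (corner m)) (embed (corner (m.+1 %% 3)%N)).

Lemma block_side z : block z <-> forall m, m \in iota 0 3 -> 0 < side m z.
Proof.
split=> [/and3P[h0 h1 h2] m|h]; first by rewrite !inE => /or3P[]/eqP ->.
by apply/and3P; split; [apply: (h 0%N)|apply: (h 1%N)|apply: (h 2%N)].
Qed.

Lemma side_seg m p q t :
  side m (padd (pscale (1 - t) (embed p)) (pscale t (embed q))) =
  (1 - t) * (sidez m p)%:~R + t * (sidez m q)%:~R.
Proof. by rewrite /side det_seg !det_point. Qed.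

Lemma misses_block p q : misses p q -> seg (embed p) (embed q) `&` block = set0.
Proof.
move=> /hasP[[[i j] k] _ /and3P[ijk cp cq]].
apply/seteqP; split=> // z [[t /andP[t0 t1] ->] /block_side h]; exfalso.
have := (h 0%N isT, h 1%N isT, h 2%N isT); rewrite !side_seg {h}.
move: ijk cp cq => /=.
move: (sidez 0 p) (sidez 1 p) (sidez 2 p) => a0 a1 a2.
move: (sidez 0 q) (sidez 1 q) (sidez 2 q) => b0 b1 b2 ijk.
rewrite -!(lerz0 R) !(rmorphD, rmorphM) /= -!pmulrn => cp cq [[h0 h1] h2].
have [i0 j0 k0] : [/\ 0 <= i%:R :> R, 0 <= j%:R :> R & 0 <= k%:R :> R] by [].
have s0 : 0 < i%:R + j%:R + k%:R :> R by rewrite -!natrD ltr0n.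
have g0 := mulr_ge0 (ltW h0) i0; have g1 := mulr_ge0 (ltW h1) j0.
have g2 := mulr_ge0 (ltW h2) k0.
(* Some weight is positive, so the combination is positive at a point of the block; but it is affine
   along the segment and nonpositive at both ends. *)
have : 0 < ((1 - t) * a0%:~R + t * b0%:~R) * i%:R
         + ((1 - t) * a1%:~R + t * b1%:~R) * j%:R
         + ((1 - t) * a2%:~R + t * b2%:~R) * k%:R.
  have [i1|i1] := ltP 0 (i%:R : R).
    by have := mulr_gt0 h0 i1; lra.
  have [j1|j1] := ltP 0 (j%:R : R).
    by have := mulr_gt0 h1 j1; lra.
  have k1 : 0 < k%:R :> R by lra.
  by have := mulr_gt0 h2 k1; lra.
have t1' : 0 <= 1 - t by rewrite subr_ge0.
by have := mulr_ge0_le0 t1' cp; have := mulr_ge0_le0 t0 cq; lra.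
Qed.

Lemma hits_block p q : hits p q -> seg (embed p) (embed q) `&` block !=set0.
Proof.
move=> /hasP[t]; rewrite mem_iota => /andP[_ t12] /allP h.
exists (padd (pscale (1 - t%:R / 12) (embed p)) (pscale (t%:R / 12) (embed q))).
split.
  exists (t%:R / 12) => //; rewrite divr_ge0//= ler_pdivrMr// mul1r ler_nat.
  exact: ltnW.
apply/block_side => m /h; rewrite side_seg.
move: (sidez m p) (sidez m q) => a b.
rewrite -(ltr0z R) rmorphD !rmorphM /= -!pmulrn natrB; last exact: ltnW.
lra.
Qed.

Definition config (i : 'I_10) : pt := embed (place i).

Lemma mem_iota10 (i : 'I_10) : nat_of_ord i \in iota 0 10.
Proof. by rewrite mem_iota add0n ltn_ord. Qed.

Lemma config_general_position : general_position config.
Proof.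
have ncol (u v w : 'I_10) : u != v -> v != w -> u != w ->
    det (config u) (config v) (config w) != 0.
  move=> uv vw uw; rewrite det_point intr_eq0.
  apply: (implyP (allP (allP (allP position_general _ (mem_iota10 u)) _
    (mem_iota10 v)) _ (mem_iota10 w))).
  by rewrite /= !inE negb_or uv uw vw.
split=> [u v e|u v w uv vw uw]; last by rewrite -det_eq0 ncol.
apply/eqP/negPn/negP => uv.
(* Two coinciding points would be collinear with any third point w. *)
have [w wu wv] : exists2 w : 'I_10, u != w & v != w.
  have : (0 < #|~: [set u; v]|)%N.
    by rewrite cardsCs finset.setCK card_ord cards2 uv.
  move=> /card_gt0P[w]; rewrite !inE negb_or eq_sym => /andP[? h].
  by exists w => //; rewrite eq_sym.
have := ncol u v w uv wv wu; rewrite e /det !subrr !mul0r subrr.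
by rewrite eqxx.
Qed.

Lemma config_rep : obstacle_rep (fun u v : 'I_10 => adj10 u v) block config.
Proof.
split.
  apply: (@triangle_obstacle _ _ _ _ (embed (0, 0))).
    by rewrite det_point ltr0z.
  by apply/and3P; rewrite !det_point !ltr0z.
split; first exact: config_general_position.
split=> [u /block_side h|u v uv].
  have /hasP[m m3] := allP position_outside _ (mem_iota10 u).
  apply/negP; rewrite -ltNge -(ltr0z R).
  by have := h m m3; rewrite /side det_point.
have := implyP (allP (allP adj10_position _ (mem_iota10 u)) _ (mem_iota10 v)) uv.
case: ifP => [a /misses_block //|na /hits_block/set0P h].
by split=> // e; move: h; rewrite e eqxx.
Qed.

Lemma rep_avoids_drawing (V : finType) (adj : rel V) (C : set pt) (f : V -> pt) :
  irreflexive adj -> obstacle_rep adj C f -> C `<=` ~` drawing adj f.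
Proof.
move=> irr [_ [_ [fC Cadj]]] z Cz [[v zv]|[u [v [uv suv]]]].
  by apply: (fC v); rewrite -zv.
have nuv : u != v by apply: contraTneq uv => ->; rewrite irr.
have := (Cadj u v nuv).1 uv; rewrite -subset0 => /(_ z); exact.
Qed.

Lemma adj10_inside : has_inside_rep R (fun u v : 'I_10 => adj10 u v).
Proof.
exists block, config; split; first exact: config_rep.
move=> x _ xunb; apply/seteqP; split=> // z [Cz xz]; apply: xunb.
set D := drawing _ config in xz *.
have CD : block `<=` ~` D.
  by apply: rep_avoids_drawing config_rep => u; rewrite /adj10 eqxx.
have C0 : block (embed (0, 0)).
  by apply/and3P; rewrite !det_point !ltr0z.
(* The block is connected and misses the drawing, so it is enough to bound the component of the
   origin. *)
have z0 : connected_component (~` D) (embed (0, 0)) z.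
  by apply: connected_component_max C0 CD _ _ Cz; exact: triangle_connected.
rewrite (same_connected_component xz) -(same_connected_component z0).
have edge (u v : 'I_10) : adj10 u v -> seg (config u) (config v) `<=` D.
  by move=> uv y ?; right; exists u, v.
pose o k (h : (k < 10)%N) : 'I_10 := Ordinal h.
(* The origin is the midpoint of the non-edge p_3 q_3, which is surrounded by the paths through p_0
   and through q_1. *)
apply: (@enclosed _ D (config (@o 3 isT)) (config (@o 7 isT))
  [:: config (@o 0 isT)] [:: config (@o 5 isT)]).
- by [].
- by split; [exact: edge|split; [exact: edge|]].
- by split; [exact: edge|split; [exact: edge|]].
- by move=> p; rewrite inE => /eqP ->; rewrite det_point ltr0z.
- by move=> p; rewrite inE => /eqP ->; rewrite det_point ltrz0.
- by left; exists (@o 3 isT).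
- by left; exists (@o 7 isT).
- exists 2^-1; first by apply/andP; split; lra.
  by apply: injective_projections; rewrite /= /padd /pscale /=; lra.
- exact: CD.
Qed.

End Representation.

(** * Stars *)

Definition star (V : finType) (o : V) : rel V :=
  fun u v => (u != v) && ((u == o) || (v == o)).

Lemma star_simple (V : finType) (o : V) : simple_graph (star o).
Proof.
by split=> [u v|u]; rewrite /star ?eqxx// eq_sym orbC.
Qed.

Section Star.
Variables (R : realType) (V : finType) (o : V).
Local Notation pt := (R * R)%type.
Implicit Types (f : V -> pt) (C : set pt).

Lemma seg_sub (a b c : pt) : seg a b c -> seg a c `<=` seg a b.
Proof.
move=> [t /andP[t0 t1] ->] _ [s /andP[s0 s1] ->].
exists (s * t).
  rewrite mulr_ge0//=; apply: (le_trans (ler_wpM2l s0 t1)).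
  by rewrite mulr1.
by apply: injective_projections; rewrite /padd /pscale /=; ring.
Qed.

Lemma star_drawing f y : drawing (star o) f y ->
  seg (f o) y `<=` drawing (star o) f.
Proof.
have spoke v : seg (f o) (f v) `<=` drawing (star o) f.
  have [->|vo] := eqVneq v o; last first.
    by move=> z ?; right; exists o, v; rewrite /star eq_sym vo eqxx.
  move=> z [t _ ->]; left; exists o.
  by apply: injective_projections; rewrite /padd /pscale /=; ring.
move=> [[v ->]|[u [v [/andP[_ /orP[]/eqP ->] yuv]]]]; first exact: spoke.
  by move=> z /(seg_sub yuv); exact: spoke.
by move=> z /(seg_sub (segC yuv)); exact: spoke.
Qed.

(* The drawing is star-shaped around the centre, so the ray issued from z and
   pointing away from the centre never meets it. *)
Lemma star_unbounded f z : ~ drawing (star o) f z ->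
  ~ bounded_pt (connected_component (~` drawing (star o) f) z).
Proof.
move=> nDz [M hM]; set D := drawing _ f in nDz hM.
pose q (s : R) : pt := padd z (pscale s (z.1 - (f o).1, z.2 - (f o).2)).
have qz s : 0 <= s -> connected_component (~` D) z (q s).
  move=> s0; apply: seg_component => y [t /andP[t0 t1] yE] Dy.
  apply/nDz/(star_drawing Dy); pose r := t * s.
  have r0 : 0 <= r by exact: mulr_ge0.
  have rn0 : 1 + r != 0 by rewrite gt_eqF// ltr_pwDl.
  (* Since y = z + r (z - o), the point z divides the segment from o to y in this ratio. *)
  exists (1 / (1 + r)).
    by rewrite divr_ge0 ?addr_ge0//= ler_pdivrMr ?ltr_pwDl// mul1r lerDl.
  rewrite yE; apply: injective_projections;
    rewrite /q /padd /pscale /=; move: rn0; rewrite /r => rn0; field; exact: rn0.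
have zo : z != f o by apply/eqP => e; apply: nDz; left; exists o.
(* Some coordinate of z differs from that of the centre, and it grows beyond any bound along the
   ray. *)
have far (a b : R) : a != b ->
    exists2 s, 0 <= s & M < `|a + s * (a - b)|.
  move=> ab; have d0 : 0 < `|a - b| by rewrite normr_gt0 subr_eq0.
  have M0 : 0 <= M.
    by have [h _] := hM _ (qz 0 (lexx 0)); apply: le_trans h.
  exists ((M + `|a| + 1) / `|a - b|).
    by rewrite divr_ge0 ?addr_ge0.
  have h : `|(M + `|a| + 1) / `|a - b| * (a - b)| = M + `|a| + 1.
    rewrite normrM normf_div normr_id divfK ?gt_eqF// ger0_norm//.
    by rewrite !addr_ge0.
  have := ler_normB (a + (M + `|a| + 1) / `|a - b| * (a - b)) a.
  by rewrite addrAC subrr add0r h; lra.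
have [e1|n1] := eqVneq z.1 (f o).1.
  have n2 : z.2 != (f o).2.
    by apply: contra zo => /eqP e2; apply/eqP/injective_projections.
  have [s s0 h] := far _ _ n2; have [_] := hM _ (qz s s0).
  by rewrite leNgt h.
have [s s0 h] := far _ _ n1; have [+ _] := hM _ (qz s s0).
by rewrite leNgt h.
Qed.

Lemma obstacle_nonempty C : obstacle C -> C !=set0.
Proof.
move=> [_ [G [_ [x nGx ->]]]]; exists x.
exact: connected_component_refl.
Qed.

Lemma star_not_inside : ~ has_inside_rep R (star o).
Proof.
move=> [C [f [rep /(_ _) ins]]].
have [z Cz] := obstacle_nonempty rep.1.
have nDz := rep_avoids_drawing (star_simple o).2 rep Cz.
have := ins z nDz (star_unbounded nDz); rewrite -subset0 => /(_ z); apply.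
by split=> //; exact: connected_component_refl.
Qed.

End Star.

(** * The two separating graphs *)

Lemma path3_outside (R : realType) :
  has_outside_rep R (star (ord0 : 'I_3)).
Proof.
(* The points p_0, p_3, q_3 of the ten induce the path with middle vertex p_0, and the same triangle
   blocks p_3 q_3. *)
pose e (i : 'I_3) : 'I_10 := inord (nth 0%N [:: 0; 3; 7]%N i).
have eE i : nat_of_ord (e i) = nth 0%N [:: 0; 3; 7]%N i.
  by rewrite inordK//; case: i => [[|[|[|]]]].
have einj : injective e.
  move=> i j /(congr1 val) /=; rewrite !eE => h; apply/val_inj.
  by case: i j h => [[|[|[|//]]] ?] [[|[|[|//]]] ?].
have adjE i j : star ord0 i j = adj10 (e i) (e j).
  rewrite /adj10 !eE /star -!val_eqE.
  by case: i j => [[|[|[|//]]] ?] [[|[|[|//]]] ?].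
have [obs [gp [fC Cadj]]] := config_rep R.
have rep : obstacle_rep (star (ord0 : 'I_3)) (@block R) (@config R \o e).
  split=> //; split; last split => [v|u v uv]; last 2 first.
  - exact: fC.
  - by rewrite adjE; apply: Cadj; rewrite (inj_eq einj).
  split=> [u v /gp.1/einj//|u v w uv vw uw].
  by apply: gp.2; rewrite (inj_eq einj).
exists (@block R), (@config R \o e); split=> //.
have [x Cx] := obstacle_nonempty obs.
have CD := rep_avoids_drawing (star_simple (ord0 : 'I_3)).2 rep.
exists x; first exact: CD.
split; first exact/star_unbounded/CD.
by apply: connected_component_max => //; exact: triangle_connected.
Qed.

Lemma adj10_not_outside (R : realType) :
  ~ has_outside_rep R (fun u v : 'I_10 => adj10 u v).
Proof.
move=> [C [f /outside_rep_chirotope]]; exact: adj10_no_chirotope.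
Qed.

Theorem theorem4 (R : realType) :
  (exists (V : finType) (adj : rel V),
      simple_graph adj /\ has_inside_rep R adj /\ ~ has_outside_rep R adj) /\
  (exists (V : finType) (adj : rel V),
      simple_graph adj /\ has_outside_rep R adj /\ ~ has_inside_rep R adj).
Proof.
split.
  exists 'I_10, (fun u v : 'I_10 => adj10 u v); split.
    by split=> [u v|u]; [exact: adj10_sym|rewrite /adj10 eqxx].
  by split; [exact: adj10_inside|exact: adj10_not_outside].
exists 'I_3, (star ord0); split; first exact: star_simple.
by split; [exact: path3_outside|exact: star_not_inside].
Qed.
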